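(* Suppose that there exists $\mathbf{w}_*\in\mathbb{R}^d$ such that $f(\mathbf{w}_* )=0$. If the invariant measure of SAGD (that is, of the Markov chain $\{\mathbf{u}_k\}$ on $\mathbb{R}^{2d}$) is unique, then it equals $(\delta(\mathbf{w}_* ),\delta(\mathbf{w}_* ))$, where $\delta(\mathbf{w}_* )$ is the Dirac measure concentrated on $\mathbf{w}_*$.
   Context: Least-squares setting: $\mathbf{z}=(\mathbf{x},y)\sim\mathcal{P}$ with $\mathbf{x}\in\mathbb{R}^d$, $y\in\mathbb{R}$; $\mathbf{x}$ has zero mean and covariance $\mathbf{S}$ with $\mu\mathbf{I}\preceq\mathbf{S}\preceq L\mathbf{I}$, $\mu>0$. $f(\mathbf{w})=\frac12\mathbf{E}[(y-\mathbf{w}^\top\mathbf{x})^2]$, stochastic gradient $\nabla f_{\mathbf{z}}(\mathbf{w})=\mathbf{x}\mathbf{x}^\top\mathbf{w}-y\mathbf{x}$, and $\mathbf{z}_n$ are i.i.d. from $\mathcal{P}$. SAGD with parameters $\alpha,\beta,\gamma$ iterates $\mathbf{w}'_{n+1}=\mathbf{w}'_n+\beta(\mathbf{w}'_n-\mathbf{w}'_{n-1})-\gamma\nabla f_{\mathbf{z}_n}\big(\mathbf{w}'_n+\alpha(\mathbf{w}'_n-\mathbf{w}'_{n-1})\big)$; $\mathbf{u}_k=(\mathbf{w}'_k,\mathbf{w}'_{k-1})$ is a Markov chain on $\mathbb{R}^{2d}$. $(\delta(\mathbf{w}_* ),\delta(\mathbf{w}_* ))$ is the law on $\mathbb{R}^{2d}$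 of the constant pair $(\mathbf{w}_*,\mathbf{w}_* )$. *)

(* Defs.v *)
(* Over [R : realType], R^d is ['cV[R]_d] and a data point z = (x, y) lives in
   ['cV[R]_d * R]; the distribution of z is a probability measure [P] on that
   product.  Built on MathComp-Analysis. *)
From HB Require Import structures.
From mathcomp Require Import all_boot all_order all_algebra.
From mathcomp Require Import all_classical all_reals all_analysis.
From mathcomp Require Import measurable_realfun.

Set Implicit Arguments.
Unset Strict Implicit.
Unset Printing Implicit Defensive.

Import Order.TTheory GRing.Theory Num.Theory.
Import numFieldNormedType.Exports.

Local Open Scope classical_set_scope.
Local Open Scope ring_scope.

(* The library equips tuples, but not matrices, with the product sigma-algebra;
   on ['cV[R]_n] with [R : realType] this is the Borel sigma-algebra of R^n. *)
Definition measure_cV_display : measure_display -> measure_display.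
Proof. exact. Qed.

Section measurable_cV.
Context {d : measure_display} {T : measurableType d} {n : nat}.

Let coors : 'I_n -> 'cV[T]_n -> T := fun i v => v i ord0.

Let cV_set0 : g_sigma_preimage coors set0.
Proof. exact: sigma_algebra0. Qed.

Let cV_setC A : g_sigma_preimage coors A -> g_sigma_preimage coors (~` A).
Proof. exact: sigma_algebraC. Qed.

Let cV_bigcup (F : _^nat) : (forall i, g_sigma_preimage coors (F i)) ->
  g_sigma_preimage coors (\bigcup_i (F i)).
Proof. exact: sigma_algebra_bigcup. Qed.

HB.instance Definition _ := @isMeasurable.Build (measure_cV_display d)
  'cV[T]_n (g_sigma_preimage coors) cV_set0 cV_setC cV_bigcup.

End measurable_cV.

Lemma measurable_coord_cV (d : measure_display) (T : measurableType d) (n : nat)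
    (i : 'I_n) : measurable_fun [set: 'cV[T]_n] (fun v => v i ord0).
Proof.
move=> _ Y mY; rewrite setTI; apply: sub_sigma_algebra => /=.
by rewrite (bigD1 i)//=; left; exists Y => //; rewrite setTI.
Qed.

Lemma measurable_fun_cVP (d1 d2 : measure_display) (T1 : measurableType d1)
    (T2 : measurableType d2) (n : nat) (f : T1 -> 'cV[T2]_n) :
  measurable_fun [set: T1] f <->
  forall i, measurable_fun [set: T1] (fun x => f x i ord0).
Proof.
split=> [mf i|mf].
  exact: (measurableT_comp (measurable_coord_cV i) mf).
pose G : set (set 'cV[T2]_n) := \big[setU/set0]_(i < n)
  preimage_set_system setT (fun v : 'cV[T2]_n => v i ord0) measurable.
apply: (@measurability _ _ _ _ setT f G) => // _ [B GB <-].
suff [i [A mA <-]] : exists i : 'I_n, preimage_set_system setT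
    (fun v : 'cV[T2]_n => v i ord0) measurable B.
  by rewrite setTI; exact: mf.
move: GB; rewrite /G; elim/big_ind : _ => //.
  by move=> x y hx hy [/hx|/hy].
by move=> i _ h; exists i.
Qed.

Section loewner.
Context (R : realType) (d : nat).
Implicit Types A B : 'M[R]_d.

Definition psdmx A : Prop :=
  A^T = A /\ forall v : 'cV[R]_d, 0 <= (v^T *m A *m v) ord0 ord0.

Definition loewner_le A B : Prop := psdmx (B - A).

End loewner.

Notation data_space R d := ('cV[R]_d * R)%type (only parsing).
Notation state_space R d := ('cV[R]_d * 'cV[R]_d)%type (only parsing).

Section sagd.
Context (R : realType) (d : nat).

Local Notation data := (data_space R d).
Local Notation state := (state_space R d).

Implicit Types (P : probability data R) (w : 'cV[R]_d).

Definition feature (i : 'I_d) : data -> R := fun z => z.1 i ord0.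

(* Extended-real valued, as the second moment of y is not assumed finite. *)
Definition risk P w : \bar R :=
  ((2^-1)%:E * 'E_P[fun z : data => ((z.2 - (w^T *m z.1) ord0 ord0) ^+ 2)%R])%E.

Definition stoch_grad (z : data) w : 'cV[R]_d :=
  z.1 *m z.1^T *m w - z.2 *: z.1.

(* u_(n+1) = sagd_step z_n u_n, for the state u_n = (w'_n, w'_(n-1)). *)
Definition sagd_step (alpha beta gamma : R) (z : data) (u : state) : state :=
  (u.1 + beta *: (u.1 - u.2)
     - gamma *: stoch_grad z (u.1 + alpha *: (u.1 - u.2)),
   u.1).

Lemma measurable_sagd_step (alpha beta gamma : R) :
  measurable_fun [set: state * data]
    (fun uz => sagd_step alpha beta gamma uz.2 uz.1).
Proof.
have mw1 i : measurable_fun [set: state * data]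
    (fun uz : state * data => uz.1.1 i ord0).
  apply: (measurableT_comp (measurable_coord_cV i)).
  exact: (measurableT_comp measurable_fst measurable_fst).
have mw2 i : measurable_fun [set: state * data]
    (fun uz : state * data => uz.1.2 i ord0).
  apply: (measurableT_comp (measurable_coord_cV i)).
  exact: (measurableT_comp measurable_snd measurable_fst).
have mx i : measurable_fun [set: state * data]
    (fun uz : state * data => uz.2.1 i ord0).
  apply: (measurableT_comp (measurable_coord_cV i)).
  exact: (measurableT_comp measurable_fst measurable_snd).
have my : measurable_fun [set: state * data]
    (fun uz : state * data => uz.2.2).
  exact: (measurableT_comp measurable_snd measurable_snd).
apply/measurable_fun_pairP; split; last first.
  exact: (measurableT_comp measurable_fst measurable_fst).
apply/measurable_fun_cVP => i.
rewrite [X in measurable_fun _ X](_ : _ = (fun uz : state * data =>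
  uz.1.1 i ord0 + beta * (uz.1.1 i ord0 - uz.1.2 i ord0)
  - gamma * ((\sum_(j < d) (uz.2.1 i ord0 * uz.2.1 j ord0) *
      (uz.1.1 j ord0 + alpha * (uz.1.1 j ord0 - uz.1.2 j ord0)))
      - uz.2.2 * uz.2.1 i ord0))); last first.
  apply/funext => uz /=; rewrite /stoch_grad !mxE; congr (_ - _ * (_ - _)).
  by apply: eq_bigr => j _; rewrite !mxE big_ord1 !mxE.
apply: measurable_funB.
  apply: measurable_funD => //; apply: measurable_funM => //.
  exact: measurable_funB.
apply: measurable_funM => //; apply: measurable_funB; last first.
  exact: measurable_funM.
apply: measurable_sum => j; apply: measurable_funM.
  exact: measurable_funM.
apply: measurable_funD => //; apply: measurable_funM => //.
exact: measurable_funB.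
Qed.

Section kernel.
Variables (P : probability data R) (alpha beta gamma : R).

(* The transition kernel of the chain (u_n): the law of [sagd_step z u] for
   z distributed as P.  As z_n has law P and is independent of u_n, this is
   the conditional law of u_(n+1) given u_n = u. *)
Definition sagd_law (u : state) : set state -> \bar R :=
  pushforward P (fun z => sagd_step alpha beta gamma z u).

Let step_measurable u :
  measurable_fun [set: data] (fun z => sagd_step alpha beta gamma z u).
Proof.
exact: (measurableT_comp (measurable_sagd_step alpha beta gamma)
  (pair1_measurable u)).
Qed.

Let sagd_law0 u : sagd_law u set0 = 0%E.
Proof. by rewrite /sagd_law /pushforward preimage_set0 measure0. Qed.

Let sagd_law_ge0 u A : (0 <= sagd_law u A)%E.
Proof. exact: measure_ge0. Qed.

Let sagd_law_sigma_additive u : semi_sigma_additive (sagd_law u).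
Proof.
exact: (@measure_semi_sigma_additive _ _ _
  (measure_function_pushforward__canonical__measure_function_Measure P
     (step_measurable u))).
Qed.

HB.instance Definition _ u := isMeasure.Build _ _ _ (sagd_law u)
  (sagd_law0 u) (@sagd_law_ge0 u) (@sagd_law_sigma_additive u).

Definition sagd_kernel (u : state) : {measure set state -> \bar R} :=
  sagd_law u.

Let measurable_sagd_kernel (U : set state) : measurable U ->
  measurable_fun [set: state] (sagd_kernel ^~ U).
Proof.
move=> mU; pose B := (fun uz : state * data =>
  sagd_step alpha beta gamma uz.2 uz.1) @^-1` U.
have mB : measurable B.
  by rewrite -[B]setTI; exact: measurable_sagd_step.
rewrite (_ : (fun u => sagd_kernel u U) = P \o xsection B).
  exact: measurable_fun_xsection.
apply/funext => u /=; congr (P _); apply/seteqP; split => z.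
  by rewrite /xsection /B /= inE.
by rewrite /xsection /B /= inE.
Qed.

HB.instance Definition _ :=
  isKernel.Build _ _ _ _ R sagd_kernel measurable_sagd_kernel.

Let sagd_kernelT u : sagd_kernel u [set: state] = 1%E.
Proof. by rewrite /= /sagd_law /pushforward preimage_setT probability_setT. Qed.

HB.instance Definition _ :=
  Kernel_isProbability.Build _ _ _ _ R sagd_kernel sagd_kernelT.

End kernel.
End sagd.

Definition invariant_prob (d : measure_display) (T : measurableType d)
    (R : realType) (k : R.-pker T ~> T) (nu : probability T R) : Prop :=
  forall A, measurable A -> (\int[nu]_u k u A)%E = nu A.

(* Measures are compared on measurable sets only: the library's measures are
   functions on all sets. *)
Definition unique_invariant_prob (d : measure_display) (T : measurableType d)
    (R : realType) (k : R.-pker T ~> T) (nu : probability T R) : Prop :=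
  invariant_prob k nu /\
  forall nu' : probability T R, invariant_prob k nu' ->
    forall A, measurable A -> nu' A = nu A.

(* Main.v *)
(* Zero risk forces y = wstar^T x almost surely, so almost every stochastic
   gradient vanishes at wstar.  The chain started at (wstar, wstar) thus stays
   there almost surely, the Dirac measure at that point is invariant, and
   uniqueness identifies it with nu. *)
Require Import Defs.
From HB Require Import structures.
From mathcomp Require Import all_boot all_order all_algebra.
From mathcomp Require Import all_classical all_reals all_analysis.
From mathcomp Require Import measurable_realfun.

Set Implicit Arguments.
Unset Strict Implicit.
Unset Printing Implicit Defensive.

Import Order.TTheory GRing.Theory Num.Theory.
Import numFieldNormedType.Exports.

Local Open Scope classical_set_scope.
Local Open Scope ring_scope.

Lemma pushforward_ae_cst (d1 d2 : measure_display) (T1 : measurableType d1)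
    (T2 : measurableType d2) (R : realType) (P : probability T1 R)
    (f : T1 -> T2) (a : T2) (A : set T2) :
  measurable_fun [set: T1] f -> measurable A ->
  {ae P, forall x, f x = a} -> pushforward P f A = \d_a A.
Proof.
move=> mf mA fa.
have mfA : measurable (f @^-1` A) by rewrite -[_ @^-1` _]setTI; exact: mf.
rewrite /pushforward -[f @^-1` A]setIT -integral_indic//.
rewrite (ae_eq_integral (cst (\d_a A : \bar R))) => //.
- rewrite integral_cst//; transitivity (\d_a A * P setT)%E => //.
  by rewrite probability_setT mule1.
- exact/measurable_EFinP/measurable_indic.
- apply: filterS fa => x fxa _ /=.
  by rewrite diracE indicE -fxa; congr (_%:R%:E); rewrite !inE.
Qed.

(** Integrating [k u A] against [\d_a] evaluates it at the absorbing point [a]. *)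
Lemma invariant_prob_dirac (d : measure_display) (T : measurableType d)
    (R : realType) (k : R.-pker T ~> T) (a : T) :
  (forall A, measurable A -> k a A = \d_a A) ->
  invariant_prob k (\d_a : probability T R).
Proof.
move=> ka A mA; rewrite integral_dirac//; last exact: measurable_kernel.
by rewrite diracT mul1e ka.
Qed.

(** The squared residual is nonnegative with zero integral, hence vanishes almost everywhere. *)
Lemma risk0_ae (R : realType) (d : nat) (P : probability (data_space R d) R)
    (w : 'cV[R]_d) :
  risk P w = 0%E -> {ae P, forall z, z.2 = (w^T *m z.1) ord0 ord0}.
Proof.
move=> /eqP; rewrite mule_eq0 eqe invr_eq0 pnatr_eq0/= unlock => /eqP r0.
set r : data_space R d -> R := fun z => z.2 - (w^T *m z.1) ord0 ord0.
have mr : measurable_fun setT r.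
  apply: measurable_funB => //.
  (* Measurability on column vectors is coordinatewise, so the inner product is expanded into a
     sum. *)
  rewrite (_ : (fun z : data_space R d => _) =
      fun z => \sum_(j < d) w j ord0 * z.1 j ord0); last first.
    by apply/funext => z; rewrite mxE; apply: eq_bigr => j _; rewrite mxE.
  apply: measurable_sum => j; apply: measurable_funM => //.
  exact: (measurableT_comp (measurable_coord_cV j) measurable_fst).
have mr2 : measurable_fun setT (fun z => (r z ^+ 2)%:E).
  by apply/measurable_EFinP; exact: measurable_funX.
have : (\int[P]_z `|(r z ^+ 2)%:E| = 0)%E.
  by rewrite -r0; apply: eq_integral => z _; rewrite /= ger0_norm ?sqr_ge0.
move/(ae_eq_integral_abs P measurableT mr2); apply: filterS => z /(_ I)[] /eqP.
by rewrite sqrf_eq0 subr_eq0 => /eqP.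
Qed.

(** Equal components cancel both momentum terms, and the gradient at [w] is the residual times a
    multiple of the feature vector. *)
Lemma sagd_step_fixed (R : realType) (d : nat) (alpha beta gamma : R)
    (z : data_space R d) (w : 'cV[R]_d) :
  z.2 = (w^T *m z.1) ord0 ord0 -> sagd_step alpha beta gamma z (w, w) = (w, w).
Proof.
move=> zw; rewrite /sagd_step /stoch_grad /= subrr !scaler0 !addr0.
(* The 1 x 1 matrix [z.1^T *m w] equals its transpose [w^T *m z.1], a scalar matrix with entry
   [z.2]. *)
rewrite -mulmxA -[z.1^T *m w]trmxK trmx_mul trmxK [w^T *m _]mx11_scalar.
by rewrite tr_scalar_mx mul_mx_scalar zw subrr scaler0 subr0.
Qed.

Theorem lemma13 (R : realType) (d : nat) (P : probability (data_space R d) R)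
    (S : 'M[R]_d) (mu L alpha beta gamma : R)
    (x_L2 : forall i : 'I_d, @feature R d i \in Lfun P 2%:E)
    (x_mean0 : forall i : 'I_d, ('E_P[@feature R d i] = 0)%E)
    (x_cov : forall i j : 'I_d,
      covariance P (@feature R d i) (@feature R d j) = (S i j)%:E)
    (mu_gt0 : 0 < mu)
    (S_lower : loewner_le mu%:M S)
    (S_upper : loewner_le S L%:M)
    (wstar : 'cV[R]_d)
    (risk_wstar : risk P wstar = 0%E)
    (nu : probability (state_space R d) R)
    (nu_unique : unique_invariant_prob (sagd_kernel P alpha beta gamma) nu) :
  forall A : set (state_space R d), measurable A ->
    nu A = \d_((wstar, wstar) : state_space R d) A.
Proof.
(* The Dirac measure is the competitor in the uniqueness clause; only its invariance remains. *)
move=> A mA; case: nu_unique => _ /(_ \d_(wstar, wstar)) <- //.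
apply: invariant_prob_dirac => B mB; apply: pushforward_ae_cst => //.
  exact: (measurableT_comp (measurable_sagd_step alpha beta gamma)
    (pair1_measurable _)).
apply: filterS (risk0_ae risk_wstar) => z; exact: sagd_step_fixed.
Qed.
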